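(* Consider problem (P): $\min_{{\bf x}\in\mathbb{R}^n} f({\bf x})+\lambda\|(A{\bf x}+{\bf b})_+\|_0$. (i) Let ${\bf x}^*$ be a local minimizer of (P) such that $A_{\Gamma_*}$ has full row rank. Then ${\bf x}^*$ is a P-stationary point of (P) with $\tau$ for every $\tau$ with $0<\tau<\tau_*:=\min\{\tau_1,\tau_2\}$. (ii) If ${\bf x}^*$ is a P-stationary point of (P) with some $\tau>0$ and $f$ is convex on a neighbourhood of ${\bf x}^*$, then ${\bf x}^*$ is a local minimizer of (P). (iii) If $f$ is strongly convex with modulus $c_f>0$ (i.e. $f({\bf x})\ge f({\bf x}')+\langle\nabla f({\bf x}'),{\bf x}-{\bf x}'\rangle+\frac{c_f}{2}\|{\bf x}-{\bf x}'\|^2$ for all ${\bf x},{\bf x}'$) and ${\bf x}^*$ is a P-stationary point of (P) with some $\tau\ge\|A\|^2/c_f$, then ${\bf x}^*$ is a global minimizer of (P).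
   Context: Standing setting: $f:\mathbb{R}^n\to\mathbb{R}$ is twice continuously differentiable, $\lambda>0$, $A\in\mathbb{R}^{m\times n}$ with rows $A_i$, ${\bf b}\in\mathbb{R}^m$; ${\bf z}_+$ is the componentwise positive part, $\|{\bf z}\|_0$ the number of nonzero entries, $A_\Gamma$ the submatrix of rows indexed by $\Gamma$, $\|A\|$ the spectral norm. For $\alpha>0$, the (set-valued) proximal operator is $\mathrm{Prox}_{\alpha\|(\cdot)_+\|_0}({\bf z}):=\arg\min_{{\bf y}\in\mathbb{R}^m}\frac12\|{\bf y}-{\bf z}\|^2+\alpha\|{\bf y}_+\|_0$; componentwise its elements ${\bf p}$ satisfy $p_i=0$ if $|z_i-\sqrt{\alpha/2}|<\sqrt{\alpha/2}$, $p_i\in\{0,z_i\}$ if $|z_i-\sqrt{\alpha/2}|=\sqrt{\alpha/2}$, $p_i=z_i$ if $|z_i-\sqrt{\alpha/2}|>\sqrt{\alpha/2}$. P-stationarity: ${\bf x}^*$ is a P-stationary point of (P) with $\tau>0$ if there exists ${\bf z}^*\in\mathbb{R}^m$ with $\nabla f({\bf x}^* )+A^\top{\bf z}^*=0$ and $A{\bf x}^*+{\bf b}\in\mathrm{Prox}_{\tau\lambda\|(\cdot)_+\|_0}(A{\bf x}^*+{\bf b}+\tau{\bf z}^* )$. For ${\bf x}^*$: ${\bf y}^*:=A{\bf x}^*+{\bf b}$, $\Gamma_*:=\{i: y^*_i=0\}$; when $A_{\Gamma_*}$ has full row rank, ${\bf p}^*:=-(A_{\Gamma_*}A_{\Gamma_*}^\top)^{-1}A_{\Gamma_*}\nabla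 f({\bf x}^* )\in\mathbb{R}^{|\Gamma_*|}$. Define $\tau_1:=+\infty$ if ${\bf y}^*\le 0$, otherwise $\tau_1:=\min\{(y_i^* )^2/(2\lambda): y_i^*>0\}$; and $\tau_2:=+\infty$ if $\Gamma_*=\emptyset$ or ${\bf p}^*=0$, otherwise $\tau_2:=2\lambda/\max_i|p^*_i|^2$. *)

(* Defs.v *)
From HB Require Import structures.
From mathcomp Require Import all_boot all_order all_algebra.
From mathcomp Require Import all_classical all_reals all_analysis.
Set Implicit Arguments. Unset Strict Implicit. Unset Printing Implicit Defensive.
Import Order.TTheory GRing.Theory Num.Theory.
Import numFieldNormedType.Exports.
Local Open Scope classical_set_scope.
Local Open Scope ring_scope.

Section Defs.
Variable R : realType.

Definition ev (n : nat) (i : 'I_n) : 'cV[R]_n := delta_mx i 0.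

Definition inner (n : nat) (u v : 'cV[R]_n) : R := \sum_i u i 0 * v i 0.
Definition enorm (n : nat) (u : 'cV[R]_n) : R := Num.sqrt (\sum_i u i 0 ^+ 2).

Definition opnorm (m n : nat) (A : 'M[R]_(m, n)) : R :=
  sup [set enorm (A *m x) | x in [set x : 'cV[R]_n | enorm x <= 1]].

Definition pospart (m : nat) (z : 'cV[R]_m) : 'cV[R]_m :=
  map_mx (fun t => Num.max t 0) z.
Definition l0 (m : nat) (z : 'cV[R]_m) : nat := #|[set i | z i 0 != 0]|.

Definition pderiv (n : nat) (i : 'I_n) (g : 'cV[R]_n -> R) : 'cV[R]_n -> R :=
  fun x => 'D_(ev i) g x.
Definition grad (n : nat) (f : 'cV[R]_n -> R) (x : 'cV[R]_n) : 'cV[R]_n :=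
  \col_i pderiv i f x.

Definition C2 (n : nat) (f : 'cV[R]_n -> R) : Prop :=
  continuous f /\
  (forall i x, derivable f x (ev i)) /\
  (forall i, continuous (pderiv i f)) /\
  (forall i j x, derivable (pderiv i f) x (ev j)) /\
  (forall i j, continuous (pderiv j (pderiv i f))).

Definition objP (m n : nat) (f : 'cV[R]_n -> R) (lam : R) (A : 'M[R]_(m, n))
  (b : 'cV[R]_m) (x : 'cV[R]_n) : R :=
  f x + lam * (l0 (pospart (A *m x + b)))%:R.

Definition local_minimizer (m n : nat) f lam A b (xs : 'cV[R]_n) : Prop :=
  \forall x \near xs, @objP m n f lam A b xs <= objP f lam A b x.

Definition global_minimizer (m n : nat) f lam A b (xs : 'cV[R]_n) : Prop :=
  forall x, @objP m n f lam A b xs <= objP f lam A b x.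

Definition in_prox (m : nat) (alpha : R) (z y : 'cV[R]_m) : Prop :=
  forall y' : 'cV[R]_m,
    enorm (y - z) ^+ 2 / 2 + alpha * (l0 (pospart y))%:R <=
    enorm (y' - z) ^+ 2 / 2 + alpha * (l0 (pospart y'))%:R.

Definition P_stationary (m n : nat) (f : 'cV[R]_n -> R) (lam : R)
  (A : 'M[R]_(m, n)) (b : 'cV[R]_m) (tau : R) (xs : 'cV[R]_n) : Prop :=
  exists zs : 'cV[R]_m,
    grad f xs + A^T *m zs = 0 /\
    in_prox (tau * lam) (A *m xs + b + tau *: zs) (A *m xs + b).

Definition Gam (m n : nat) (A : 'M[R]_(m, n)) (b : 'cV[R]_m) (xs : 'cV[R]_n)
  : {set 'I_m} := [set i | (A *m xs + b) i 0 == 0].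

Definition subrows (m n : nat) (G : {set 'I_m}) (A : 'M[R]_(m, n))
  : 'M[R]_(#|G|, n) := \matrix_(k, j) A (enum_val k) j.

Definition pstar (m n : nat) (f : 'cV[R]_n -> R) (A : 'M[R]_(m, n))
  (b : 'cV[R]_m) (xs : 'cV[R]_n) : 'cV[R]_#|Gam A b xs| :=
  let AG := subrows (Gam A b xs) A in
  - (invmx (AG *m AG^T) *m AG *m grad f xs).

Definition tau1 (m n : nat) (lam : R) (A : 'M[R]_(m, n)) (b : 'cV[R]_m)
  (xs : 'cV[R]_n) : \bar R :=
  \big[Order.min/+oo%E]_(i | 0 < (A *m xs + b) i 0)
     (((A *m xs + b) i 0) ^+ 2 / (2 * lam))%:E.

Definition tau2 (m n : nat) (f : 'cV[R]_n -> R) (lam : R) (A : 'M[R]_(m, n))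
  (b : 'cV[R]_m) (xs : 'cV[R]_n) : \bar R :=
  let p := pstar f A b xs in
  if (Gam A b xs == finset.set0) || (p == 0) then +oo%E
  else ((2 * lam) / \big[Num.max/0]_i (`|p i 0| ^+ 2))%:E.

End Defs.

(* Main.v *)
(* Sufficiency: for a prox point the multiplier z vanishes where y = A x + b is nonzero and is
   nonnegative where y = 0, so the gradient inequality <grad f, d> = - <z, A d> bounds the loss
   of f by the jump of the l0 term locally; comparing y with A x + b in the prox inequality
   itself gives the global bound once (cf / 2) |d|^2 dominates |A d|^2 / (2 tau).
   Necessity: the l0 term does not increase along small steps in a direction d with
   A_G d <= 0, hence <grad f, d> >= 0 there. Full row rank of A_G then forces
   grad f + A_G^T p = 0 with p >= 0, and the extension of p by zero is the multiplier. *)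

Require Import Defs.
From HB Require Import structures.
From mathcomp Require Import all_boot all_order all_algebra.
From mathcomp Require Import all_classical all_reals all_analysis.
From mathcomp Require Import ring lra.
Import Order.TTheory GRing.Theory Num.Theory.
Import numFieldNormedType.Exports.
Local Open Scope classical_set_scope.
Local Open Scope ring_scope.

Set Implicit Arguments.
Unset Strict Implicit.

(** The norm on column vectors is the max norm; this bound turns coordinate increments into
    distances, as the balls of radius [r] below require. *)
Lemma ev_norm (R : realType) n (i : 'I_n) : `|ev R i| <= 1.
Proof.
rewrite [`|_|]mx_normrE; apply: bigmax_le => //= ij _.
by rewrite mxE normr_nat lern1 leq_b1.
Qed.

Lemma near_forall_fin (T : topologicalType) (I : finType) (P : I -> T -> Prop) (x : T) :
  (forall i, \forall y \near x, P i y) -> \forall y \near x, forall i, P i y.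
Proof.
move=> H; have := @filter_forall _ _ (P : _ -> set _) _ (nbhs_filter x) H.
by apply: filterS => y Hy i; exact: Hy.
Qed.

(** * Directional derivatives from continuous partial derivatives *)

Section FirstOrder.
Variables (R : realType) (n : nat) (f : 'cV[R]_n -> R).
Hypothesis df : forall i x, derivable f x (ev R i).

Lemma is_derive_along (i : 'I_n) (y : 'cV[R]_n) (t : R) :
  is_derive t 1 (fun s : R => f (s *: ev R i + y)) (pderiv i f (t *: ev R i + y)).
Proof.
have E (h : R) : (h *: (1 : R) + t) *: ev R i + y
    = h *: ev R i + (t *: ev R i + y).
  by rewrite [h *: _]mulr1 scalerDl addrA.
apply: DeriveDef.
  rewrite /derivable /=; under eq_fun do rewrite E.
  exact: df.
by rewrite /derive /=; under eq_fun do rewrite E.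
Qed.

(** The bound [|c| <= |s|] treats both signs of [s] alike; for [s < 0] the mean value theorem is
    applied on [[s, 0]] and the increment is reversed. *)
Lemma coordinate_MVT (i : 'I_n) (y : 'cV[R]_n) (s : R) :
  exists2 c : R, `|c| <= `|s| &
    f (s *: ev R i + y) - f y = pderiv i f (c *: ev R i + y) * s.
Proof.
pose g (t : R) := f (t *: ev R i + y).
have dg (t : R) : is_derive t (1 : R) g (pderiv i f (t *: ev R i + y)).
  exact: is_derive_along.
have cg : continuous g.
  move=> t; apply: differentiable_continuous; apply/derivable1_diffP.
  by case: (dg t).
have g0 : g 0 = f y by rewrite /g scale0r add0r.
have [s0|s0] := leP 0 s.
  have [c] := MVT_segment s0 (fun t _ => dg t) (continuous_subspaceT cg).
  rewrite in_itv/= => /andP[c0 cs].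
  rewrite g0 subr0 => E; exists c => //.
  by rewrite !ger0_norm.
have [c] := MVT_segment (ltW s0) (fun t _ => dg t) (continuous_subspaceT cg).
rewrite in_itv/= => /andP[sc c0].
rewrite g0 sub0r mulrN => E; exists c.
  by rewrite ler0_norm // ltr0_norm // lerN2.
by rewrite -[LHS]opprB E opprK.
Qed.

(* The coordinates of [h] are added one at a time, with the mean value theorem at each step. *)
Lemma first_order_bound (x : 'cV[R]_n) (e r : R) (h : 'I_n -> R) (s : seq 'I_n) :
  (forall i v, `|v| < r -> `|pderiv i f (v + x) - pderiv i f x| <= e) ->
  \sum_(i <- s) `|h i| < r ->
  `|f (\sum_(i <- s) h i *: ev R i + x) - f x - \sum_(i <- s) pderiv i f x * h i|
    <= e * \sum_(i <- s) `|h i|.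
Proof.
move=> De; elim: s => [|i s IH].
  by rewrite !big_nil add0r subrr subr0 mulr0 normr0.
rewrite !big_cons => hr.
set S := \sum_(j <- s) h j *: ev R j in IH *.
have nS : `|S| <= \sum_(j <- s) `|h j|.
  apply: le_trans (ler_norm_sum _ _ _) _; apply: ler_sum => j _.
  by rewrite normrZ ler_piMr // ev_norm.
have {}IH := IH (le_lt_trans (ler_wpDl (normr_ge0 _) (lexx _)) hr).
have [c cs E] := coordinate_MVT i (S + x) (h i).
rewrite -[in f _]addrA.
have -> : f (h i *: ev R i + (S + x)) - f x -
    (pderiv i f x * h i + \sum_(j <- s) pderiv j f x * h j)
  = (pderiv i f (c *: ev R i + (S + x)) - pderiv i f x) * h i +
    (f (S + x) - f x - \sum_(j <- s) pderiv j f x * h j).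
  by rewrite mulrBl -E; ring.
rewrite mulrDr; apply: le_trans (ler_normD _ _) _; apply: lerD => //.
rewrite normrM ler_wpM2r // addrA De //.
apply: le_lt_trans hr; apply: le_trans (ler_normD _ _) _; apply: lerD => //.
by rewrite normrZ (le_trans _ cs) // ler_piMr // ev_norm.
Qed.

Hypothesis cdf : forall i, continuous (pderiv i f).

(** Continuity of the partial derivatives at [x] makes the error in [first_order_bound] at most
    [e / M * h] times the sum of the [|d_i|], hence at most [e * h]. *)
Lemma directional_derivative (x d : 'cV[R]_n) :
  h^-1 * (f (h *: d + x) - f x) @[h --> (0 : R)^'+] --> inner (grad f x) d.
Proof.
apply/cvgrPdist_le => e e0.
(* The added [1] keeps [M] positive when [d = 0]. *)
pose M := \sum_i `|d i 0| + 1.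
have M0 : 0 < M by rewrite ltr_wpDl // sumr_ge0.
have : \forall y \near x, forall i, `|pderiv i f x - pderiv i f y| <= e / M.
  apply: near_forall_fin => i.
  by have /cvgrPdist_le /(_ _ (divr_gt0 e0 M0)) := @cdf i x.
move=> /nbhs_ballP[r /= r0 De].
near=> h.
have hp : 0 < h by near: h; exact: nbhs_right_gt.
have h0 : h != 0 by rewrite gt_eqF.
have hr : `|h| < r / M.
  by rewrite gtr0_norm //; near: h; apply: nbhs_right_lt; exact: divr_gt0.
have Ed : h *: d = \sum_i (h * d i 0) *: ev R i.
  apply/matrixP => i j; rewrite ord1 !mxE summxE (bigD1 i) //= big1 => [|k ki].
    by rewrite !mxE !eqxx mulr1 addr0.
  by rewrite !mxE eq_sym (negbTE ki) mulr0.
have nd : \sum_i `|h * d i 0| = `|h| * (\sum_i `|d i 0|).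
  by rewrite mulr_sumr; apply: eq_bigr => i _; rewrite normrM.
have := @first_order_bound x (e / M) r (fun i => h * d i 0) (index_enum _).
rewrite nd -Ed => B.
have {}B : `|f (h *: d + x) - f x - \sum_i pderiv i f x * (h * d i 0)| <=
    e / M * (`|h| * \sum_i `|d i 0|).
  apply: B.
  - move=> i v vr; rewrite distrC; apply: De.
    by rewrite -ball_normE /= opprD addrCA subrr addr0 normrN.
  - apply: le_lt_trans (_ : _ <= `|h| * M) _; first by rewrite ler_wpM2l // lerDl.
    by rewrite -ltr_pdivlMr.
have E : \sum_i pderiv i f x * (h * d i 0) = h * inner (grad f x) d.
  rewrite mulr_sumr; apply: eq_bigr => i _; rewrite mxE; ring.
rewrite E in B; rewrite distrC.
have -> : h^-1 * (f (h *: d + x) - f x) - inner (grad f x) d =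
   h^-1 * (f (h *: d + x) - f x - h * inner (grad f x) d).
  by rewrite [RHS]mulrBr mulKf.
rewrite normrM normfV ler_pdivrMl ?normr_gt0 //.
apply: le_trans B _; rewrite mulrCA; apply: ler_wpM2l => //.
by rewrite -mulrA ler_piMr // ?(ltW e0) // mulrC ler_pdivrMr // mul1r lerDl.
Unshelve. all: by end_near.
Qed.


Lemma directional_derivative_ge (x d : 'cV[R]_n) (c : R) :
  (\forall h \near (0 : R)^'+, c * h <= f (h *: d + x) - f x) ->
  c <= inner (grad f x) d.
Proof.
move=> H; apply: (cvgr_to_ge (@directional_derivative x d)).
near=> h; have h0 : 0 < h by near: h; exact: nbhs_right_gt.
by rewrite ler_pdivlMl // mulrC; near: h.
Unshelve. all: by end_near.
Qed.

Lemma directional_derivative_le (x d : 'cV[R]_n) (c : R) :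
  (\forall h \near (0 : R)^'+, f (h *: d + x) - f x <= c * h) ->
  inner (grad f x) d <= c.
Proof.
move=> H; apply: (cvgr_to_le (@directional_derivative x d)).
near=> h; have h0 : 0 < h by near: h; exact: nbhs_right_gt.
by rewrite ler_pdivrMl // mulrC; near: h.
Unshelve. all: by end_near.
Qed.

(** Convexity along the segment gives [f (x + t (y - x)) - f x <= t (f y - f x)]; divide by [t] and
    let it tend to 0 from the right. *)
Lemma convex_gradient_le (x : 'cV[R]_n) (e : R) : 0 < e ->
  (forall y z : 'cV[R]_n, ball x e y -> ball x e z -> forall t : R, 0 <= t <= 1 ->
     f ((1 - t) *: y + t *: z) <= (1 - t) * f y + t * f z) ->
  forall y, ball x e y -> f x + inner (grad f x) (y - x) <= f y.
Proof.
move=> e0 cvx y xy; rewrite addrC -lerBrDr; apply: directional_derivative_le.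
near=> t.
have t0 : 0 < t by near: t; exact: nbhs_right_gt.
have t1 : t < 1 by near: t; exact: nbhs_right_lt.
have t01 : 0 <= t <= 1 by rewrite !ltW.
have := cvx x y (ballxx _ e0) xy t t01.
have -> : (1 - t) *: x + t *: y = t *: (y - x) + x.
  by apply/matrixP => i j; rewrite !mxE; ring.
by lra.
Unshelve. all: by end_near.
Qed.

End FirstOrder.

(** A sum of indicators makes the penalty separable over the coordinates. *)
Lemma l0_pospartE (R : realType) m (y : 'cV[R]_m) :
  (l0 (pospart y))%:R = \sum_i (0 < y i 0)%R%:R :> R.
Proof.
rewrite -natr_sum; congr _%:R; rewrite /l0 -sum1_card big_mkcond.
apply: eq_bigr => i _.
have -> : (i \in [set i | (pospart y) i 0 != 0]) = (0 < y i 0).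
  have -> : (0 < y i 0) = (pospart y i 0 != 0).
    rewrite mxE; case: ltP => h; first by rewrite gt_eqF.
    by rewrite eqxx.
  by apply/idP/idP; rewrite inE.
by case: ifP.
Qed.

(** * Inner product, Euclidean norm and spectral norm *)

Section Euclidean.
Variable R : realType.

Lemma inner_mx n (u v : 'cV[R]_n) : inner u v = (u^T *m v) 0 0.
Proof. by rewrite mxE; apply: eq_bigr => i _; rewrite mxE. Qed.

Lemma inner_adjoint m n (A : 'M[R]_(m, n)) u v :
  inner (A^T *m u) v = inner u (A *m v).
Proof. by rewrite !inner_mx trmx_mul trmxK mulmxA. Qed.

Lemma inner_delta n (u : 'cV[R]_n) i : inner u (delta_mx i 0) = u i 0.
Proof. by rewrite inner_mx -colE !mxE. Qed.

Lemma innerN n (u v : 'cV[R]_n) : inner (- u) v = - inner u v.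
Proof. by rewrite !inner_mx linearN mulNmx mxE. Qed.

Lemma innerNr n (u v : 'cV[R]_n) : inner u (- v) = - inner u v.
Proof. by rewrite !inner_mx mulmxN mxE. Qed.

Lemma innerB n (u v w : 'cV[R]_n) : inner (u - v) w = inner u w - inner v w.
Proof. by rewrite !inner_mx linearB mulmxBl !mxE. Qed.

Lemma inner_eq0 n (u : 'cV[R]_n) : inner u u <= 0 -> u = 0.
Proof.
move=> le0; have ge0 i : true -> 0 <= u i 0 * u i 0 by rewrite -expr2 sqr_ge0.
have : inner u u == 0 by rewrite eq_le le0 sumr_ge0.
rewrite psumr_eq0 // => /allP z; apply/matrixP => i j; rewrite ord1 mxE.
by have := z i (mem_index_enum _); rewrite /= mulf_eq0 orbb => /eqP.
Qed.

Lemma enorm_sqr n (u : 'cV[R]_n) : enorm u ^+ 2 = \sum_i u i 0 ^+ 2.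
Proof. by rewrite sqr_sqrtr // sumr_ge0 // => i _; rewrite sqr_ge0. Qed.

Lemma enorm_ge0 n (u : 'cV[R]_n) : 0 <= enorm u.
Proof. exact: sqrtr_ge0. Qed.

Lemma enormZ n (a : R) (u : 'cV[R]_n) : enorm (a *: u) = `|a| * enorm u.
Proof.
rewrite -sqrtr_sqr -sqrtrM ?sqr_ge0 // mulr_sumr; congr Num.sqrt.
by apply: eq_bigr => i _; rewrite mxE exprMn.
Qed.

Lemma enorm_eq0 n (u : 'cV[R]_n) : enorm u = 0 -> u = 0.
Proof.
move=> u0; apply: inner_eq0; rewrite /inner.
under eq_bigr do rewrite -expr2; by rewrite -enorm_sqr u0 expr0n.
Qed.

(** Needed for the supremum in [opnorm] to dominate its set. Each [|x_j|] is at most [enorm x <= 1],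
    so entry [i] of [A x] is bounded by the sum of the [|A_ij|]. *)
Lemma has_ubound_opnorm m n (A : 'M[R]_(m, n)) :
  has_ubound [set enorm (A *m x) | x in [set x : 'cV[R]_n | enorm x <= 1]].
Proof.
exists (Num.sqrt (\sum_i (\sum_j `|A i j|) ^+ 2)) => _ [x /= x1 <-].
apply: ler_wsqrtr; apply: ler_sum => i _.
rewrite -[X in X <= _]real_normK ?num_real // lerXn2r ?nnegrE ?sumr_ge0 //.
rewrite mxE; apply: le_trans (ler_norm_sum _ _ _) _; apply: ler_sum => j _.
rewrite normrM ler_piMr //; apply: le_trans x1.
rewrite -sqrtr_sqr; apply: ler_wsqrtr.
by rewrite (bigD1 j) //= lerDl sumr_ge0 // => k _; rewrite sqr_ge0.
Qed.

Lemma opnorm_bound m n (A : 'M[R]_(m, n)) x : enorm (A *m x) <= opnorm A * enorm x.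
Proof.
have [x0|x0] := eqVneq (enorm x) 0.
  rewrite x0 mulr0 (enorm_eq0 x0) mulmx0 /enorm big1 ?sqrtr0 // => i _.
  by rewrite mxE expr0n.
have xp : 0 < enorm x by rewrite lt0r x0 enorm_ge0.
(* The normalised vector is admissible in the supremum; the estimate is then scaled back. *)
have : enorm (A *m ((enorm x)^-1 *: x)) <= opnorm A.
  apply: (ub_le_sup (has_ubound_opnorm A)).
  by exists ((enorm x)^-1 *: x) => //=; rewrite enormZ gtr0_norm ?invr_gt0 // mulVf.
by rewrite -scalemxAr enormZ gtr0_norm ?invr_gt0 // mulrC ler_pdivrMr.
Qed.

Lemma enorm_sqrB n (u v : 'cV[R]_n) :
  enorm (u - v) ^+ 2 = enorm u ^+ 2 - 2 * inner v u + enorm v ^+ 2.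
Proof.
rewrite !enorm_sqr mulr_sumr -sumrB -big_split; apply: eq_bigr => i _.
by rewrite /= !mxE; ring.
Qed.

End Euclidean.

(** * The proximal operator, coordinate by coordinate *)

Section Prox.
Variables (R : realType) (m : nat) (alpha : R).

Lemma in_proxE (z y : 'cV[R]_m) :
  in_prox alpha z y <-> forall w : 'cV[R]_m,
    \sum_i ((y i 0 - z i 0) ^+ 2 / 2 + alpha * (0 < y i 0)%R%:R) <=
    \sum_i ((w i 0 - z i 0) ^+ 2 / 2 + alpha * (0 < w i 0)%R%:R).
Proof.
have E w : enorm (w - z) ^+ 2 / 2 + alpha * (l0 (pospart w))%:R =
   \sum_i ((w i 0 - z i 0) ^+ 2 / 2 + alpha * (0 < w i 0)%R%:R).
  rewrite enorm_sqr l0_pospartE mulr_suml mulr_sumr -big_split.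
  by apply: eq_bigr => i _; rewrite !mxE.
by split=> H w; have := H w; rewrite !E.
Qed.

(** A competitor that differs from [y] in entry [i] alone leaves all other terms equal; conversely,
    the coordinate inequalities add up. *)
Lemma in_prox_coord (z y : 'cV[R]_m) :
  in_prox alpha z y <-> forall i (t : R),
    (y i 0 - z i 0) ^+ 2 / 2 + alpha * (0 < y i 0)%R%:R <=
    (t - z i 0) ^+ 2 / 2 + alpha * (0 < t)%R%:R.
Proof.
split=> [/in_proxE H i t|H].
  have := H (\col_j (if j == i then t else y j 0)).
  rewrite (bigD1 i) //= [leRHS](bigD1 i) //= !mxE eqxx.
  under [X in _ <= _ + X]eq_bigr => j ji do rewrite !mxE (negbTE ji).
  by rewrite lerD2r.
by apply/in_proxE => w; apply: ler_sum.
Qed.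

(** With [v = tau z] this is the inclusion in P-stationarity. The quadratic term vanishes at
    [t = y_i + v_i], the main test value below. *)
Lemma in_prox_shift (v y : 'cV[R]_m) :
  in_prox alpha (y + v) y <-> forall i (t : R),
    (v i 0) ^+ 2 / 2 + alpha * (0 < y i 0)%R%:R <=
    (t - y i 0 - v i 0) ^+ 2 / 2 + alpha * (0 < t)%R%:R.
Proof.
have E i : y i 0 - (y + v) i 0 = - v i 0 by rewrite mxE; ring.
have E' i t : t - (y + v) i 0 = t - y i 0 - v i 0 by rewrite mxE; ring.
by split=> [/in_prox_coord H i t|H]; last (apply/in_prox_coord => i t);
  move: (H i t); rewrite E E' sqrrN.
Qed.

End Prox.

(** * Proximal inclusion and conditions on the multiplier *)

Section Stationary.
Variables (R : realType) (m : nat) (tau lam : R).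
Hypotheses (tau0 : 0 < tau) (lam0 : 0 < lam).

(** Test the prox inequality at [y + a] and expand the squares: the terms [tau^2 |z|^2 / 2] cancel,
    and dividing by [tau] gives the claim. *)
Lemma in_prox_descent (y z a : 'cV[R]_m) : in_prox (tau * lam) (y + tau *: z) y ->
  lam * (l0 (pospart y))%:R + inner z a <=
  lam * (l0 (pospart (y + a)))%:R + enorm a ^+ 2 / (2 * tau).
Proof.
move=> /(_ (y + a)).
have -> : y - (y + tau *: z) = (- tau) *: z.
  by rewrite opprD addNKr scaleNr.
have -> : y + a - (y + tau *: z) = a - tau *: z.
  by rewrite opprD addrACA subrr add0r.
rewrite enorm_sqrB !enormZ normrN.
have -> : inner (tau *: z) a = tau * inner z a.
  by rewrite mulr_sumr; apply: eq_bigr => i _; rewrite mxE mulrA.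
move=> H; rewrite -(ler_pM2l tau0).
set q := enorm a ^+ 2 / (2 * tau).
have tq : tau * q = enorm a ^+ 2 / 2 by rewrite /q; field; exact: lt0r_neq0.
by lra.
Qed.

Lemma in_prox_multiplier (y z : 'cV[R]_m) i :
  in_prox (tau * lam) (y + tau *: z) y ->
  (y i 0 != 0 -> z i 0 = 0) /\ (y i 0 = 0 -> 0 <= z i 0).
Proof.
move=> /in_prox_shift/(_ i); rewrite mxE; set a := y i 0; set c := z i 0 => H.
have E : tau * c = 0 -> c = 0.
  by move=> /eqP; rewrite mulf_eq0 (gt_eqF tau0) => /eqP.
split=> [a0|a0].
  apply: E; set e := tau * c in H *.
  have S : e ^+ 2 <= 0 -> e = 0.
    by move=> h; apply/eqP; rewrite -sqrf_eq0 eq_le h sqr_ge0.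
  have tl0 : 0 < tau * lam by exact: mulr_gt0.
  have [an|ap|] := ltgtP a 0; last by move/eqP: a0.
  - have [ae|ae] := leP (a + e) 0.
      apply: S; have := H (a + e); rewrite !ltNge ae (ltW an) /=; lra.
    (* Here [a < 0 < a + e], so [t = a + e] would be penalised; [t = 0] is not, and it gives
       [0 <= a (a + 2 e)], against the sign of this product. *)
    have : 0 < - a * (a + e + e) by apply: mulr_gt0; lra.
    by have := H 0; rewrite !ltNge lexx (ltW an) /=; lra.
  (* Since [a > 0] already pays the penalty, moving to [t = a + e] pays no more, which forces
     [e ^+ 2 <= 0]. *)
  - apply: S; have [ae|ae] := leP (a + e) 0; have := H (a + e); rewrite ap.
      by rewrite ltNge ae /=; have := sqr_ge0 e; lra.
    by rewrite ae /=; lra.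
(* If [c < 0], the value [t = tau * c] is negative, hence free of penalty, and cancels the quadratic
   term. *)
rewrite leNgt; apply/negP => c0; have e0 : tau * c < 0 by rewrite pmulr_rlt0.
by have := H (tau * c); rewrite a0 ltxx ltNge (ltW e0) /=; nra.
Qed.

(** From [y_i > 0], dropping to [t <= 0] costs at least [y_i^2 / 2 >= tau lam]. From [y_i = 0],
    rising to [t > 0] costs [tau lam >= (tau z_i)^2 / 2], and [z_i >= 0] means that no [t <= 0]
    comes closer to [tau z_i]. The two thresholds are those encoded in [tau1] and [tau2]. *)
Lemma in_prox_intro (y z : 'cV[R]_m) :
  (forall i, 0 < y i 0 -> 2 * (tau * lam) <= y i 0 ^+ 2) ->
  (forall i, y i 0 != 0 -> z i 0 = 0) ->
  (forall i, y i 0 = 0 -> 0 <= z i 0 /\ tau * z i 0 ^+ 2 <= 2 * lam) ->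
  in_prox (tau * lam) (y + tau *: z) y.
Proof.
move=> Hp Hn H0; apply/in_prox_shift => i t; rewrite mxE.
move: (Hp i) (Hn i) (H0 i); set a := y i 0; set c := z i 0 => hp hn h0.
have tl0 : 0 < tau * lam by exact: mulr_gt0.
have [a0|a0|a0] := ltgtP a 0.
- rewrite hn ?lt_eqF // mulr0 subr0.
  by case: (0 < t); rewrite /=; have := sqr_ge0 (t - a); lra.
- rewrite hn ?gt_eqF // mulr0 subr0.
  have {}hp := hp a0; have [t0|t0] := ltP 0 t; rewrite /=; last nra.
  by have := sqr_ge0 (t - a); lra.
have [c0 hc] := h0 a0; rewrite a0 subr0.
have {}hc : tau * (tau * c ^+ 2) <= tau * (2 * lam) by rewrite ler_pM2l.
have tc0 : 0 <= tau * c by rewrite mulr_ge0 // ltW.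
have [t0|t0] := ltP 0 t; rewrite /=; last nra.
have := sqr_ge0 (t - tau * c); rewrite exprMn; lra.
Qed.

End Stationary.

(** * Full row rank, the Gram matrix and extension by zero *)

Section LinearAlgebra.
Variable R : realType.

(** If [u B B^T = 0] then [|u B|^2 = u B B^T u^T = 0], so [u B = 0], and full row rank gives
    [u = 0]. *)
Lemma gram_unitmx k n (B : 'M[R]_(k, n)) : \rank B = k -> B *m B^T \in unitmx.
Proof.
move=> rk; have free : row_free B by apply/eqP.
rewrite -row_free_unit -kermx_eq0; apply/rowV0P => u /sub_kermxP uBB.
have : (u *m B)^T = 0.
  apply: inner_eq0; rewrite inner_mx trmxK trmx_mul mulmxA -[u *m _ *m _]mulmxA.
  by rewrite uBB mul0mx mxE.
move=> /(congr1 trmx); rewrite trmxK trmx0 => /eqP.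
by rewrite mulmx_free_eq0 // => /eqP.
Qed.

(* The residual [r] of [g] after projection onto the row space of [B] lies in the kernel of
   [B], so [- r] is a feasible direction; [- B^T (B B^T)^-1 e_k] is another one, and it
   isolates the [k]-th multiplier. *)
Lemma least_squares_multiplier k n (B : 'M[R]_(k, n)) (g : 'cV[R]_n) :
  let p := - (invmx (B *m B^T) *m B *m g) in
  \rank B = k ->
  (forall d : 'cV[R]_n, (forall i, (B *m d) i 0 <= 0) -> 0 <= inner g d) ->
  g + B^T *m p = 0 /\ forall i, 0 <= p i 0.
Proof.
move=> p rk dir; have U := gram_unitmx rk.
set r := g + B^T *m p.
have Br : B *m r = 0.
  by rewrite mulmxDr mulmxN mulmxN !mulmxA mulmxV // mul1mx subrr.
have gE : g = r - B^T *m p by rewrite addrK.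
have innerBp d : inner (B^T *m p) d = inner p (B *m d) by rewrite inner_adjoint.
have r0 : r = 0.
  apply: inner_eq0; rewrite -oppr_ge0.
  have -> : - inner r r = inner g (- r).
    by rewrite innerNr gE innerB innerBp Br [inner p 0]inner_mx mulmx0 mxE subr0.
  by apply: dir => i; rewrite mulmxN Br oppr0 mxE.
split=> // i.
pose d := - (B^T *m (invmx (B *m B^T) *m delta_mx i 0)) : 'cV[R]_n.
have Bd : B *m d = - delta_mx i 0 by rewrite mulmxN !mulmxA mulmxV // mul1mx.
have : 0 <= inner g d.
  by apply: dir => j; rewrite Bd !mxE oppr_le0 ler0n.
by rewrite gE r0 sub0r innerN innerBp Bd innerNr opprK inner_delta.
Qed.

Variables (m : nat) (G : {set 'I_m}).

(** Row selection as a 0-1 matrix: its transpose extends a vector on [G] by zero, so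
    [A_G^T p = A^T (select^T p)] is plain associativity. *)
Definition select : 'M[R]_(#|G|, m) := \matrix_(k, i) (enum_val k == i)%:R.

Lemma selectE n (B : 'M[R]_(m, n)) k j : (select *m B) k j = B (enum_val k) j.
Proof.
rewrite mxE (bigD1 (enum_val k)) //= big1 => [|i ki].
  by rewrite mxE eqxx mul1r addr0.
by rewrite mxE eq_sym (negbTE ki) mul0r.
Qed.

Lemma subrowsE n (B : 'M[R]_(m, n)) : subrows G B = select *m B.
Proof. by apply/matrixP => k j; rewrite selectE mxE. Qed.

Lemma select_trmx_in (p : 'cV[R]_#|G|) k : (select^T *m p) (enum_val k) 0 = p k 0.
Proof.
rewrite mxE (bigD1 k) //= big1 => [|l lk].
  by rewrite !mxE eqxx mul1r addr0.
by rewrite !mxE (inj_eq enum_val_inj) (negbTE lk) mul0r.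
Qed.

Lemma select_trmx_notin (p : 'cV[R]_#|G|) i : i \notin G -> (select^T *m p) i 0 = 0.
Proof.
move=> iG; rewrite mxE big1 // => k _; rewrite !mxE.
by case: eqP => [E|]; [move: iG; rewrite -E enum_valP|rewrite mul0r].
Qed.

End LinearAlgebra.

(** * Stationarity and minimality for the penalised problem *)

Section Problem.
Variables (R : realType) (m n : nat) (f : 'cV[R]_n -> R) (lam : R).
Variables (A : 'M[R]_(m, n)) (b : 'cV[R]_m).

Lemma affine_coord_continuous i : continuous (fun x : 'cV[R]_n => (A *m x + b) i 0).
Proof.
have -> : (fun x : 'cV[R]_n => (A *m x + b) i 0) =
    (fun x => \sum_j A i j * x j 0 + b i 0).
  by apply/funext => x; rewrite !mxE.
have cg : continuous (fun x : 'cV[R]_n => \sum_j A i j * x j 0 : R).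
  apply: (@continuous_big _ _ +%R 0 xpredT); first exact: add_continuous.
  move=> j _ y.
  exact: (cvgM (cvg_cst (A i j)) (@coord_continuous _ _ _ j 0 y)).
by move=> x; exact: (cvgD (cg x) (cvg_cst (b i 0))).
Qed.

(** Strict signs are open conditions on finitely many rows; null rows impose nothing. *)
Lemma near_affine_sign (xs : 'cV[R]_n) : \forall x \near xs, forall i,
  (0 < (A *m xs + b) i 0 -> 0 < (A *m x + b) i 0) /\
  ((A *m xs + b) i 0 < 0 -> (A *m x + b) i 0 < 0).
Proof.
apply: near_forall_fin => i.
have C := @affine_coord_continuous i xs.
have [lt0|gt0|eq0] := ltgtP ((A *m xs + b) i 0) 0.
- near=> x; split=> // _; near: x; exact: (cvgr_lt _ C _ lt0).
- near=> x; split=> // _; near: x; exact: (cvgr_gt _ C _ gt0).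
- by near=> x.
Unshelve. all: by end_near.
Qed.

(** Along [xs + h d] nonzero entries of [A x + b] keep their signs and null ones become
    [h (A d)_i <= 0]; the penalty does not grow, so [f] cannot decrease. *)
Lemma local_minimizer_direction (xs d : 'cV[R]_n) :
  (forall i x, derivable f x (ev R i)) -> (forall i, continuous (pderiv i f)) ->
  0 <= lam -> local_minimizer f lam A b xs ->
  (forall i, (A *m xs + b) i 0 = 0 -> (A *m d) i 0 <= 0) ->
  0 <= inner (grad f xs) d.
Proof.
move=> df cdf lam0 xmin hd; apply: directional_derivative_ge => //.
have C : h *: d + xs @[h --> (0 : R)^'+] --> xs.
  apply: cvg_at_right_filter; rewrite -[X in _ --> X]add0r -(scale0r d).
  apply: cvgD; last exact: cvg_cst.
  by apply: cvgZr_tmp; exact: cvg_id.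
near=> h; have h0 : 0 < h by near: h; exact: nbhs_right_gt.
have H1 : objP f lam A b xs <= objP f lam A b (h *: d + xs).
  by near: h; exact: C xmin.
have H2 : forall i,
    (0 < (A *m xs + b) i 0 -> 0 < (A *m (h *: d + xs) + b) i 0) /\
    ((A *m xs + b) i 0 < 0 -> (A *m (h *: d + xs) + b) i 0 < 0).
  by near: h; exact: C (near_affine_sign xs).
rewrite mul0r subr_ge0 -(lerD2r (lam * (l0 (pospart (A *m xs + b)))%:R)).
apply: le_trans H1 _; rewrite lerD2l ler_wpM2l // !l0_pospartE.
apply: ler_sum => i _; rewrite ler_nat.
have [pos neg] := H2 i.
have [lt0|gt0|eq0] := ltgtP ((A *m xs + b) i 0) 0 => //.
- by rewrite ltNge (ltW (neg lt0)).
- by rewrite leq_b1.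
rewrite leqn0 eqb0 -leNgt mulmxDr -addrA mxE eq0 addr0 -scalemxAr mxE.
by rewrite pmulr_rle0 // hd.
Unshelve. all: by end_near.
Qed.

Lemma stationary_inner (xs : 'cV[R]_n) (z : 'cV[R]_m) (d : 'cV[R]_n) :
  grad f xs + A^T *m z = 0 -> inner (grad f xs) d = - inner z (A *m d).
Proof. by move=> /eqP; rewrite addr_eq0 => /eqP ->; rewrite innerN inner_adjoint. Qed.

Lemma affineB (x xs : 'cV[R]_n) : A *m xs + b + A *m (x - xs) = A *m x + b.
Proof. by rewrite mulmxBr addrAC addrCA subrr addr0. Qed.

Lemma P_stationary_local_minimizer (tau : R) (xs : 'cV[R]_n) (e : R) :
  0 < tau -> 0 < lam -> 0 < e ->
  (forall y, ball xs e y -> f xs + inner (grad f xs) (y - xs) <= f y) ->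
  P_stationary f lam A b tau xs -> local_minimizer f lam A b xs.
Proof.
move=> tau0 lam0 e0 tangent [z [stat prox]].
have mult i := in_prox_multiplier tau0 lam0 i prox.
(* On a null row this reads [z_i (A x + b)_i < lam]: the linear loss stays below the price of one
   new positive entry. *)
have small : \forall x \near xs, forall i,
    z i 0 * (A *m x + b) i 0 < z i 0 * (A *m xs + b) i 0 + lam.
  apply: near_forall_fin => i.
  have C : z i 0 * (A *m x + b) i 0 @[x --> xs] --> z i 0 * (A *m xs + b) i 0.
    exact: (cvgM (cvg_cst (z i 0)) (@affine_coord_continuous i xs)).
  by apply: (cvgr_lt _ C); rewrite ltrDl.
have near_ball : \forall x \near xs, ball xs e x by exact: nbhsx_ballx.
near=> x.
have pos i : 0 < (A *m xs + b) i 0 -> 0 < (A *m x + b) i 0.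
  suff H : forall j, (0 < (A *m xs + b) j 0 -> 0 < (A *m x + b) j 0) /\
      ((A *m xs + b) j 0 < 0 -> (A *m x + b) j 0 < 0) by case: (H i).
  by near: x; exact: near_affine_sign.
have lt_lam : forall i, z i 0 * (A *m x + b) i 0 < z i 0 * (A *m xs + b) i 0 + lam.
  by near: x.
have tg : f xs + inner (grad f xs) (x - xs) <= f x by apply: tangent; near: x.
rewrite (stationary_inner _ stat) in tg.
(* Stationarity has replaced the gradient term by the multiplier, so what remains is a comparison
   that can be made row by row. *)
suff : inner z (A *m (x - xs)) + lam * (l0 (pospart (A *m xs + b)))%:R <=
    lam * (l0 (pospart (A *m x + b)))%:R by rewrite /objP; lra.
have -> : A *m (x - xs) = A *m x + b - (A *m xs + b).
  by rewrite -(affineB x xs) addrAC subrr add0r.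
rewrite !l0_pospartE !mulr_sumr -big_split; apply: ler_sum => i _ /=.
have [z0 zge0] := mult i; have {}pos := pos i; have {}lt_lam := lt_lam i.
rewrite [X in _ * X]mxE [X in _ * (_ + X)]mxE.
set y := (A *m xs + b) i 0 in z0 zge0 pos lt_lam *.
set w := (A *m x + b) i 0 in pos lt_lam *.
have [y0|y0|y0] := ltgtP y 0.
- by rewrite z0 ?lt_eqF // mul0r add0r mulr0 mulr_ge0 // ltW.
- by rewrite z0 ?gt_eqF // mul0r add0r pos.
(* On a null row, [w > 0] is paid for by [lam], while [w <= 0] gives [z_i w <= 0]. *)
have {}zge0 := zge0 y0; rewrite y0 in lt_lam *.
have [w0|w0] := ltP 0 w; rewrite /= ?mulr0 ?mulr1 subr0 addr0; first lra.
exact: mulr_ge0_le0.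
Unshelve. all: by end_near.
Qed.

(** Taking [a = A (x - xs)] in [in_prox_descent] leaves the gap [|A (x - xs)|^2 / (2 tau)], which
    the strong convexity term absorbs because [opnorm A ^+ 2 <= tau * cf]. *)
Lemma P_stationary_global_minimizer (cf tau : R) (xs : 'cV[R]_n) :
  0 < cf -> 0 < tau -> 0 < lam ->
  (forall x, f xs + inner (grad f xs) (x - xs) + cf / 2 * enorm (x - xs) ^+ 2 <= f x) ->
  opnorm A ^+ 2 / cf <= tau -> P_stationary f lam A b tau xs ->
  global_minimizer f lam A b xs.
Proof.
move=> cf0 tau0 lam0 strong tauA [z [stat prox]] x.
have := strong x; rewrite (stationary_inner _ stat).
have := in_prox_descent tau0 (A *m (x - xs)) prox; rewrite affineB.
set N := enorm (A *m (x - xs)); set D := enorm (x - xs).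
suff : N ^+ 2 / (2 * tau) <= cf / 2 * D ^+ 2 by rewrite /objP; lra.
have ND : N <= opnorm A * D by exact: opnorm_bound.
have N0 : 0 <= N by exact: enorm_ge0.
have D0 : 0 <= D ^+ 2 by exact: sqr_ge0.
have {}ND : N ^+ 2 <= opnorm A ^+ 2 * D ^+ 2.
  by rewrite -exprMn lerXn2r // nnegrE (le_trans N0 ND).
rewrite ler_pdivrMr ?mulr_gt0 //.
rewrite ler_pdivrMr // in tauA.
have : opnorm A ^+ 2 * D ^+ 2 <= tau * cf * D ^+ 2 by exact: ler_wpM2r.
by lra.
Qed.

(** The multiplier is [p] extended by zero. The bound by [tau1] yields [2 tau lam <= y_i^2] on
    positive rows, the bound by [tau2] yields [tau p_k^2 <= 2 lam] on null rows. *)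
Lemma local_minimizer_P_stationary (xs : 'cV[R]_n) (tau : R) :
  (forall i x, derivable f x (ev R i)) -> (forall i, continuous (pderiv i f)) ->
  0 < lam -> local_minimizer f lam A b xs ->
  \rank (subrows (Gam A b xs) A) = #|Gam A b xs| ->
  0 < tau -> (tau%:E < Order.min (tau1 lam A b xs) (tau2 f lam A b xs))%E ->
  P_stationary f lam A b tau xs.
Proof.
move=> df cdf lam0 xmin rk tau0; rewrite lt_min => /andP[lt1 lt2].
set G := Gam A b xs in rk *; set p := pstar f A b xs.
have memG i : (i \in G) = ((A *m xs + b) i 0 == 0) by rewrite inE.
have dir d : (forall k, (subrows G A *m d) k 0 <= 0) -> 0 <= inner (grad f xs) d.
  move=> hd; apply: (local_minimizer_direction df cdf (ltW lam0) xmin) => i /eqP.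
  rewrite -memG => iG; have := hd (enum_rank_in iG i).
  by rewrite subrowsE -mulmxA selectE enum_rankK_in.
have [stat p0] := least_squares_multiplier rk dir.
rewrite -[- _]/p in stat p0.
exists ((select R G)^T *m p); split.
  by rewrite mulmxA -trmx_mul -subrowsE.
apply: in_prox_intro => //.
- move=> i y0; move/bigmin_gtP: lt1 => [_ /(_ i y0)].
  by rewrite lte_fin ltr_pdivlMr ?mulr_gt0 // => /ltW; rewrite mulrCA.
- by move=> i y0; rewrite select_trmx_notin // memG.
move=> i /eqP; rewrite -memG => iG.
rewrite -(enum_rankK_in iG iG); set k := enum_rank_in iG i.
rewrite select_trmx_in; split; first exact: p0.
(* For [p_k = 0] the bound is immediate; otherwise [G] is nonempty and [p] nonzero, so [tau2] takes
   its finite value, with a positive maximum as denominator. *)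
have [->|pk0] := eqVneq (p k 0) 0; first by rewrite expr0n mulr0 mulr_ge0 // ltW.
have pn0 : p != 0 by apply: contraNneq pk0 => ->; rewrite mxE.
have Gn0 : G != finset.set0 by apply/finset.set0Pn; exists i.
move: lt2; rewrite /tau2 -/p -/G (negbTE pn0) (negbTE Gn0) /= lte_fin.
have le_max : p k 0 ^+ 2 <= \big[Num.max/0]_i (`|p i 0| ^+ 2).
  by rewrite -real_normK ?num_real //; exact: (le_bigmax 0 (fun i => `|p i 0| ^+ 2)).
have sq0 : 0 < p k 0 ^+ 2 by rewrite exprn_even_gt0.
rewrite ltr_pdivlMr ?(lt_le_trans sq0) // => /ltW; apply: le_trans.
by rewrite ler_pM2l.
Qed.

End Problem.

Unset Implicit Arguments.
Set Strict Implicit.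

Theorem theorem3p1 (R : realType) (m n : nat) (f : 'cV[R]_n -> R) (lam : R)
  (A : 'M[R]_(m, n)) (b : 'cV[R]_m) (hf : C2 f) (hlam : 0 < lam) :
  (* (i) *)
  (forall xs : 'cV[R]_n,
     local_minimizer f lam A b xs ->
     \rank (subrows (Gam A b xs) A) = #|Gam A b xs| ->
     forall tau : R, 0 < tau ->
       (tau%:E < Order.min (tau1 lam A b xs) (tau2 f lam A b xs))%E ->
       P_stationary f lam A b tau xs) /\
  (* (ii) *)
  (forall (xs : 'cV[R]_n) (tau : R), 0 < tau ->
     P_stationary f lam A b tau xs ->
     (exists e : R, 0 < e /\
        forall x y : 'cV[R]_n, ball xs e x -> ball xs e y ->
        forall t : R, 0 <= t <= 1 ->
          f ((1 - t) *: x + t *: y) <= (1 - t) * f x + t * f y) ->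
     local_minimizer f lam A b xs) /\
  (* (iii) *)
  (forall cf : R, 0 < cf ->
     (forall x x' : 'cV[R]_n,
        f x' + inner (grad f x') (x - x') + cf / 2 * enorm (x - x') ^+ 2 <= f x) ->
     forall (xs : 'cV[R]_n) (tau : R), 0 < tau ->
       opnorm A ^+ 2 / cf <= tau ->
       P_stationary f lam A b tau xs ->
       global_minimizer f lam A b xs).
Proof.
have [_ [df [cdf _]]] := hf.
split; [|split].
- move=> xs xmin rk tau tau0 lt_tau.
  exact: (local_minimizer_P_stationary df cdf hlam xmin rk tau0 lt_tau).
- move=> xs tau tau0 stat [e [e0 cvx]].
  apply: (P_stationary_local_minimizer tau0 hlam e0 _ stat).
  exact: (convex_gradient_le df cdf e0 cvx).
move=> cf cf0 strong xs tau tau0 tauA stat.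
exact: (P_stationary_global_minimizer cf0 tau0 hlam (strong ^~ xs) tauA stat).
Qed.
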